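(* Let $G$ be a finitely generated group and $H\le G$ a subgroup. There exist a finite alphabet $A$ and a non-empty $G$-subshift $X\subseteq A^G$ with $\mathrm{stab}(X)=\{H\}$ if and only if $H$ is normal in $G$.
   Context: Let $A$ be a non-empty finite set. $G$ acts on $A^G=\{x:G\to A\}$ by $(g\cdot x)(h)=x(g^{-1}h)$. A $G$-subshift is a subset $X\subseteq A^G$ that is $G$-invariant and closed in the product topology ($A$ discrete); equivalently, it is the set of configurations avoiding some (possibly infinite) set of forbidden patterns. For $x\in A^G$, $\mathrm{stab}(x)=\{g\in G: g\cdot x=x\}$, and $\mathrm{stab}(X)=\{\mathrm{stab}(x): x\in X\}$. *)

(* Defs.v *)
From mathcomp Require Import all_boot.
From mathcomp Require Import all_classical.
From mathcomp Require Import topology.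

Set Implicit Arguments.
Unset Strict Implicit.
Unset Printing Implicit Defensive.

Local Open Scope classical_set_scope.
Local Open Scope group_scope.

Section Groups.
Variable G : groupType.

Definition subgroup (H : set G) : Prop := group_closed [in H].

(* [x ^ g] is the conjugate g^-1 * x * g. *)
Definition normal_subgroup (H : set G) : Prop :=
  subgroup H /\ forall g x : G, H x -> H (x ^ g).

Definition generated (S : set G) : set G := smallest subgroup S.

Definition finitely_generated : Prop :=
  exists S : set G, finite_set S /\ generated S = [set: G].

End Groups.

(* The full shift A^G, with the product of the discrete topologies on A. *)
Definition config (G : groupType) (A : finType) : Type :=
  {ptws G -> discrete_topology A}.

Section Shift.
Variables (G : groupType) (A : finType).
Implicit Types (x : config G A) (X : set (config G A)).

Definition shift (g : G) x : config G A := fun h => x (g^-1 * h).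

Definition subshift X : Prop :=
  (forall g x, X x -> X (shift g x)) /\ closed X.

Definition stab x : set G := [set g | shift g x = x].

Definition stabs X : set (set G) := stab @` X.

End Shift.

(* Main.v *)
Require Import Defs.
From mathcomp Require Import all_boot.
From mathcomp Require Import all_classical.
From mathcomp Require Import topology.
From mathcomp Require Import zify.

Set Implicit Arguments.
Unset Strict Implicit.
Unset Printing Implicit Defensive.

Local Open Scope classical_set_scope.

(** Translating a configuration conjugates its stabiliser. Hence if all the
    stabilisers of an invariant set are equal to H, then H is normal.

    Conversely let H be normal. A coloring of G that is constant on the cosets
    of H has H in its stabiliser, since g h = h (g ^ h). To keep the
    stabiliser from being larger in a whole subshift, each g outside H gets a
    finite window T_g, and a configuration x is required to satisfy, for every
    position h, that x (h t) <> x (h g t) for some t in T_g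
    ([subshift_of_coloring]). These conditions are closed and invariant, so
    one coloring satisfying them suffices. If G / H is finite, color each coset
    by itself, with windows reduced to 1.

    If G / H is infinite, number the elements of G and give to the i-th one a
    window of i + 1 elements such that the cosets of T_g and of g T_g are all
    distinct ([disjoint_window]); such windows exist because each new point has
    only finitely many cosets to avoid, and because g moves every coset, H
    being normal. The condition attached to (g, h) says that the word read on
    h T_g differs from the word read on h g T_g. A given coset lies in at most
    2 (i + 1) of the pairs of words of length i + 1.

    A coloring of the cosets with 10 colors satisfying all these conditions
    exists by a counting argument in the style of Rosenfeld
    ([card_proper_on]). Color the vertices of a finite set one at a time and
    follow the number N(S) of proper colorings of the colored part S: by
    induction, each new vertex multiplies N by at least 2. It would multiply N
    by 10 if no condition became violated. If a condition of length i + 1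
    becomes violated, the colors of its half D containing the new vertex are
    determined by the other half; so there are at most N(S \ D) such
    colorings, and N(S \ D) <= N(S) / 2 ^ i by induction. Altogether at most
    N(S) (sum of 2 (i + 1) / 2 ^ i) = 8 N(S) colorings are lost, and
    10 - 8 = 2. Compactness then gives a coloring of all cosets. *)

(** * Pairs of words to be separated *)

(** A list of pairs encodes two words of the same length, so that matching
    positions are kept together: the first components and the second ones. *)
Definition separates (V : Type) (A : eqType) (f : V -> A)
    (e : seq (V * V)) : bool :=
  has (fun p => f p.1 != f p.2) e.

Definition flip (V : Type) (e : seq (V * V)) := [seq (p.2, p.1) | p <- e].

Definition ends (V : Type) (e : seq (V * V)) := unzip1 e ++ unzip2 e.

Lemma flipK V : involutive (@flip V).
Proof. by elim=> [|[a b] e] //= ->. Qed.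

Lemma unzip1_flip V (e : seq (V * V)) : unzip1 (flip e) = unzip2 e.
Proof. by rewrite /unzip1 /flip -map_comp. Qed.

Lemma unzip2_flip V (e : seq (V * V)) : unzip2 (flip e) = unzip1 e.
Proof. by rewrite /unzip2 /flip -map_comp. Qed.

Lemma mem_ends_flip (V : eqType) (e : seq (V * V)) :
  ends (flip e) =i ends e.
Proof.
by move=> x; rewrite /ends unzip1_flip unzip2_flip !mem_cat orbC.
Qed.

Lemma separates_flip V (A : eqType) (f : V -> A) e :
  separates f (flip e) = separates f e.
Proof.
by rewrite /separates /flip has_map; apply: eq_has => p /=; rewrite eq_sym.
Qed.

(** * Counting colorings of finitely many vertices *)

Section Counting.
(* The finite set operations share their names and notations with those on
   classical sets. *)
Import mathcomp.boot.fintype mathcomp.boot.finset.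

(** A coloring that does not separate e is determined by its values off the
    first word of e, because the second word repeats the first. Recoloring the
    first word arbitrarily is therefore injective, and P is stable under such
    recolorings. *)
Lemma card_unseparated (U A : finType) (e : seq (U * U))
    (P : {set {ffun U -> A}}) :
  uniq (ends e) ->
  (forall f f' : {ffun U -> A},
     {in [predC unzip1 e], f =1 f'} -> f \in P -> f' \in P) ->
  #|[set f in P | ~~ separates f e]| * #|A| ^ size e <= #|P|.
Proof.
rewrite cat_uniq => /and3P[uniq1 /hasPn disj _] invP.
pose over (fw : {ffun U -> A} * (size e).-tuple A) : {ffun U -> A} :=
  [ffun x => if x \in unzip1 e then nth (fw.1 x) fw.2 (index x (unzip1 e))
             else fw.1 x].
rewrite -card_tuple -cardsT -cardsX.
rewrite -(card_in_imset (f := over)) => [|[f w] [f' w']].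
  apply/subset_leq_card/subsetP => _ /imsetP[[f w] /setXP[+ _] ->].
  rewrite inE => /andP[fP _]; apply: invP fP => x /negPf xe.
  by rewrite ffunE xe.
rewrite !inE !andbT /= => /andP[_ sf] /andP[_ sf'] /ffunP eqo.
have off x : x \notin unzip1 e -> f x = f' x.
  by move=> /negPf xe; have := eqo x; rewrite !ffunE xe.
have paired (g : {ffun U -> A}) p : ~~ separates g e ->
    p \in e -> g p.1 = g p.2.
  by move=> /hasPn sg /sg; rewrite negbK => /eqP.
congr (_, _).
  apply/ffunP => x; have [/mapP[p pe ->]|/off //] := boolP (x \in unzip1 e).
  by rewrite !paired //; apply: off; apply/disj/map_f.
apply/eq_from_tnth => i; set x0 := (tnth (in_tuple e) i).1.
have ie : i < size (unzip1 e) by rewrite size_map.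
have := eqo (nth x0 (unzip1 e) i).
by rewrite !ffunE mem_nth // index_uniq // -!tnth_nth.
Qed.

Variables (U : finType) (E : seq (U * U) -> Prop).
Hypothesis E_uniq : forall e, E e -> uniq (ends e).
Hypothesis E_neq0 : forall e, E e -> 0 < size e.
Hypothesis E_flip : forall e, E e -> E (flip e).
(* The first word suffices to bound all the constraints through a vertex v,
   because E is stable under exchanging the two words. *)
Hypothesis E_sparse : forall v i, exists2 s : seq (seq (U * U)),
  size s <= i.+1.*2 &
  forall e, E e -> size e = i.+1 -> v \in unzip1 e -> e \in s.

(** The colorings are defined on all of U even when only S is constrained, so
    that the colorings of different sets S live in one type. Compared with the
    number N(S) of colorings of S alone, the cardinal is multiplied by
    10 ^ #|~: S|; the inequality 2 N(S) <= N(v |: S) thus becomes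
    #|proper_on S| <= 5 * #|proper_on (v |: S)|. *)
Definition proper_on (S : {set U}) : {set {ffun U -> 'I_10}} :=
  [set f : {ffun U -> 'I_10} |
    `[< forall e, E e -> {subset ends e <= S} -> separates f e >]].

Lemma proper_onP (S : {set U}) (f : {ffun U -> 'I_10}) :
  reflect (forall e, E e -> {subset ends e <= S} -> separates f e)
    (f \in proper_on S).
Proof. by rewrite inE; apply: asboolP. Qed.

Lemma proper_onS (S S' : {set U}) :
  S \subset S' -> proper_on S' \subset proper_on S.
Proof.
move=> /subsetP SS'; apply/subsetP => f /proper_onP fS'.
by apply/proper_onP => e Ee eS; apply: fS' => // x /eS /SS'.
Qed.

(** The growth inequality for one vertex, iterated along the elements of D. It
    is only assumed for sets smaller than S, as this lemma serves in its
    inductive proof. *)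
Lemma card_proper_on_add k (S D : {set U}) :
  (forall (S' : {set U}) v, #|S'| < k -> v \notin S' ->
     #|proper_on S'| <= 5 * #|proper_on (v |: S')|) ->
  D \subset S -> #|S| <= k ->
  #|proper_on (S :\: D)| <= 5 ^ #|D| * #|proper_on S|.
Proof.
move=> IH; elim: {D}#|D| {-2}D (erefl #|D|) => [|n IHn] D cD DS Sk.
  by rewrite (cards0_eq cD) setD0 cards0 mul1n.
have [v vD] : exists v, v \in D by apply/card_gt0P; rewrite cD.
have vS : v \in S by apply: (subsetP DS).
have -> : S :\: D = S :\: (v |: D :\ v) by rewrite setD1K.
have cD1 : #|D :\ v| = n by move: cD; rewrite (cardsD1 v) vD => -[].
have D1S : D :\ v \subset S by apply: subset_trans DS; rewrite subsetDl.
have eS : S :\: (D :\ v) = v |: (S :\: (v |: D :\ v)).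
  apply/setP => x; rewrite !inE; case: eqVneq => [->|//]; by rewrite vS.
have := IHn (D :\ v) cD1 D1S Sk; rewrite eS cD cD1 expnS -mulnA => IHv.
apply: leq_trans (leq_mul (leqnn 5) IHv); apply: IH.
  by apply: leq_trans Sk; apply: proper_card; apply/properP; split;
    [rewrite subsetDl | exists v => //; rewrite !inE eqxx].
by rewrite !inE eqxx.
Qed.

(** Set to be empty when e is not a constraint on v |: S through v, so that a
    union bound may range over any list containing these constraints. *)
Definition newly_violated v (S : {set U}) (e : seq (U * U)) :
    {set {ffun U -> 'I_10}} :=
  if `[< [/\ E e, v \in unzip1 e & {subset ends e <= v |: S}] >]
  then [set f in proper_on S | ~~ separates f e] else set0.

(** Let D be the first word of e without v. A coloring counted here is proper
    on S :\: D, a condition that does not involve the first word at all, so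
    imposing equality with the second word costs a factor 10 ^ i.+1. Restoring
    the i vertices of D costs back 5 ^ i, by induction. *)
Lemma card_newly_violated v (S : {set U}) (e : seq (U * U)) i :
  (forall (S' : {set U}) v, #|S'| < #|S| -> v \notin S' ->
     #|proper_on S'| <= 5 * #|proper_on (v |: S')|) ->
  v \notin S -> size e = i.+1 ->
  10 * 2 ^ i * #|newly_violated v S e| <= #|proper_on S|.
Proof.
move=> IH vS se; rewrite /newly_violated.
case: asboolP => [[Ee ve eS]|_]; last by rewrite cards0 muln0.
pose D := [set x in unzip1 e] :\ v.
have DS : D \subset S.
  apply/subsetP => x; rewrite !inE => /andP[/negPf xv xe].
  by have := eS x; rewrite mem_cat xe !inE xv; apply.
have cD : #|D| = i.
  have /(congr1 predn) : #|[set x in unzip1 e]| = i.+1.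
    rewrite cardsE -se -(size_map fst); apply/card_uniqP.
    by have := E_uniq Ee; rewrite cat_uniq => /and3P[].
  by rewrite (cardsD1 v) inE ve.
have := card_proper_on_add IH DS (leqnn _); rewrite cD => SD.
have uD : #|[set f in proper_on (S :\: D) | ~~ separates f e]| * 10 ^ i.+1
    <= #|proper_on (S :\: D)|.
  have := card_unseparated (P := proper_on (S :\: D)) (E_uniq Ee).
  rewrite card_ord se; apply=> f f' ff' /proper_onP fP; apply/proper_onP.
  move=> e' Ee' e'S; have := fP _ Ee' e'S; congr is_true.
  have off x : x \in ends e' -> f x = f' x.
    move=> /e'S; rewrite !inE negb_and negbK => /andP[h xS]; apply: ff'.
    case/orP: h => [/eqP xv|//]; by rewrite xv (negPf vS) in xS.
  apply: eq_in_has => p pe'.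
  by rewrite !off // mem_cat map_f ?orbT.
have sub : #|[set f in proper_on S | ~~ separates f e]| <=
    #|[set f in proper_on (S :\: D) | ~~ separates f e]|.
  apply/subset_leq_card/subsetP => f /setIdP[fS sf].
  apply/setIdP; split=> //; apply: subsetP fS; apply: proper_onS.
  exact: subsetDl.
have : 5 ^ i * (10 * 2 ^ i * #|[set f in proper_on S | ~~ separates f e]|) <=
    5 ^ i * #|proper_on S|.
  apply: leq_trans SD; apply: leq_trans uD.
  rewrite expnS (expnMn 5 2).
  rewrite mulnA [X in X * _ <= _]mulnCA mulnC leq_mul2r sub orbT //.
by rewrite leq_pmul2l ?expn_gt0.
Qed.

(** The bound sum_(i < K) (i + 1) / 2 ^ i = 4 - 2 (K + 2) / 2 ^ K, multiplied
    out in order to stay in the natural numbers. *)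
Lemma sum_geometric_bound (x : nat -> nat) m K :
  (forall i, 10 * 2 ^ i * x i <= i.+1.*2 * m) ->
  10 * 2 ^ K * (\sum_(i < K) x i) + 4 * K.+2 * m <= 8 * 2 ^ K * m.
Proof.
move=> xm; elim: K => [|K IH]; first by rewrite big_ord0; lia.
rewrite big_ord_recr /= expnS; have := xm K.
move: (\sum_(i < K) x i) (x K) (2 ^ K) IH => s y t; nia.
Qed.

(** A proper coloring of S that is not proper on v |: S violates a constraint
    through v, in one of the two words, hence in the first word up to
    exchanging them. The union bound loses at most 8/10 of the colorings. *)
Lemma card_proper_on (S : {set U}) v : v \notin S ->
  #|proper_on S| <= 5 * #|proper_on (v |: S)|.
Proof.
have [k] := ubnP #|S|; elim: k => // k IHk in S v *; rewrite ltnS => Sk vS.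
have IH (S' : {set U}) w : #|S'| < #|S| -> w \notin S' ->
    #|proper_on S'| <= 5 * #|proper_on (w |: S')|.
  by move=> S'S; apply: IHk; apply: leq_trans Sk.
have [s s_size s_cover] : exists2 s : nat -> seq (seq (U * U)),
    forall i, size (s i) <= i.+1.*2 &
    forall i e, E e -> size e = i.+1 -> v \in unzip1 e -> e \in s i.
  have [s sP] := choice (fun i => let: ex_intro2 s s1 s2 := E_sparse v i in
    ex_intro (fun s => size s <= i.+1.*2 /\
      forall e, E e -> size e = i.+1 -> v \in unzip1 e -> e \in s) s (conj s1 s2)).
  by exists s => i; have [] := sP i.
pose s' i := [seq e <- s i | size e == i.+1].
pose x i := \sum_(e <- s' i) #|newly_violated v S e|.
have x_bound i : 10 * 2 ^ i * x i <= i.+1.*2 * #|proper_on S|.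
  rewrite /x big_distrr /=.
  apply: (@leq_trans (\sum_(e <- s' i) #|proper_on S|)).
    rewrite !big_seq; apply: leq_sum => e.
    rewrite mem_filter => /andP[/eqP se _].
    exact: card_newly_violated.
  rewrite big_const_seq count_predT iter_addn_0 mulnC leq_mul2r.
  apply/orP; right; apply: leq_trans (s_size i).
  by rewrite size_filter count_size.
have cover : #|proper_on S| <= #|proper_on (v |: S)| + \sum_(i < #|U|) x i.
  pose B := \bigcup_(i < #|U|) \bigcup_(e <- s' i) newly_violated v S e.
  have BS : #|B| <= \sum_(i < #|U|) x i.
    rewrite /B; elim/big_ind2: _ => [|? ? ? ? h1 h2|i _].
        by rewrite cards0.
      by apply: leq_trans (leq_card_setU _ _) (leq_add h1 h2).
    rewrite /x; elim/big_ind2: _ => [|? ? ? ? h1 h2|//].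
      by rewrite cards0.
    by apply: leq_trans (leq_card_setU _ _) (leq_add h1 h2).
  apply: leq_trans (leq_add (leqnn _) BS).
  apply: leq_trans (leq_card_setU _ _); apply/subset_leq_card/subsetP => f fS.
  rewrite inE; case: (boolP (f \in proper_on _)) => //= /proper_onP nf.
  have [e [Ee eS sf]] : exists e,
      [/\ E e, {subset ends e <= v |: S} & ~~ separates f e].
    apply: contrapT => nex; apply: nf => e Ee eS; apply: contrapT => sf.
    by apply: nex; exists e; split=> //; apply/negP.
  wlog ve : e Ee eS sf / v \in unzip1 e.
    move=> wl; have [|v1] := boolP (v \in unzip1 e); first exact: wl Ee eS sf.
    have [v2|v2] := boolP (v \in unzip2 e).
      apply: (wl (flip e)); rewrite ?separates_flip ?unzip1_flip //.
        exact: E_flip.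
      by move=> y; rewrite mem_ends_flip; apply: eS.
    case/negP: sf; have /proper_onP -> // := fS => y ye.
    have := eS y ye; rewrite !inE => /orP[/eqP yv|//].
    by move: ye; rewrite yv mem_cat (negPf v1) (negPf v2).
  (* The vertices of the first word are distinct: lengths are at most #|U|. *)
  have se : (size e).-1.+1 = size e by rewrite prednK ?E_neq0.
  have eU : (size e).-1 < #|U|.
    rewrite se -(size_map fst) -(card_uniqP _) ?max_card //.
    by have := E_uniq Ee; rewrite cat_uniq => /and3P[].
  apply/bigcupP; exists (Ordinal eU) => //=.
  rewrite (big_rem e) /=; last by rewrite mem_filter se eqxx s_cover.
  rewrite in_setU; apply/orP; left.
  rewrite /newly_violated; case: asboolP => [_|[]//].
  by rewrite inE fS.
have := sum_geometric_bound #|U| x_bound.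
have : 0 < 2 ^ #|U| by rewrite expn_gt0.
move: cover; move: (\sum_(i < _) _) (2 ^ _) => t p; nia.
Qed.

Lemma finite_separating : exists f : U -> 'I_10, forall e, E e -> separates f e.
Proof.
have : 0 < #|proper_on setT|.
  have := @card_proper_on_add #|U| setT setT.
  rewrite setDT => /(_ (fun S v _ => @card_proper_on S v)).
  rewrite subxx cardsT => /(_ isT (leqnn _)).
  suff : 0 < #|proper_on set0|.
    by case: #|proper_on setT| => //; rewrite muln0; lia.
  apply/card_gt0P; exists [ffun=> ord0]; apply/proper_onP => e Ee e0.
  case: e Ee e0 => [/E_neq0//|p e] _ /(_ p.1); rewrite inE eqxx => /(_ isT).
  by rewrite inE.
move=> /card_gt0P[f /proper_onP fP]; exists f => e Ee.
by apply: fP => // x; rewrite inE.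
Qed.

End Counting.

(** * Compactness *)

Lemma nbhs_agree (V : choiceType) (A : finType)
    (x : {ptws V -> discrete_topology A}) (s : seq V) :
  nbhs x [set y : {ptws V -> discrete_topology A} | {in s, y =1 x}].
Proof.
elim: s => [|v s IHs]; first exact: filterS filterT.
have xv : nbhs x [set y : {ptws V -> discrete_topology A} | y v = x v].
  apply: (@proj_continuous V (fun=> discrete_topology A) v x [set x v]).
  by rewrite nbhs_principalE.
apply: filterS (filterI xv IHs) => y [yv ys] w.
by rewrite in_cons => /predU1P[->|/ys].
Qed.

(** A set whose membership can be refuted by looking at finitely many
    coordinates is closed. *)
Lemma closed_agree (V : choiceType) (A : finType)
    (X : set {ptws V -> discrete_topology A}) :
  (forall x, ~ X x -> exists s : seq V, forall y, X y -> ~ {in s, y =1 x}) ->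
  closed X.
Proof.
move=> Xfin x clXx; apply: contrapT => /Xfin[s sX].
by have [y [/sX]] := clXx _ (nbhs_agree x s).
Qed.

Section Countable.
Variables (V : choiceType) (E : seq (V * V) -> Prop).
Hypothesis E_uniq : forall e, E e -> uniq (ends e).
Hypothesis E_neq0 : forall e, E e -> 0 < size e.
Hypothesis E_flip : forall e, E e -> E (flip e).
Hypothesis E_sparse : forall v i, exists2 s : seq (seq (V * V)),
  size s <= i.+1.*2 &
  forall e, E e -> size e = i.+1 -> v \in unzip1 e -> e \in s.

(** Transports [finite_separating] to the vertices in L, with the constraints
    that lie entirely in L. *)
Lemma separating_seq (L : seq V) : exists f : V -> 'I_10,
  forall e, E e -> {subset ends e <= L} -> separates f e.
Proof.
pose U : finType := seq_sub L.
pose push (e : seq (U * U)) :=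
  [seq ((@ssval _ L) p.1, (@ssval _ L) p.2) | p <- e].
have push1 e : unzip1 (push e) = map (@ssval _ L) (unzip1 e).
  by rewrite /unzip1 -!map_comp.
have push2 e : unzip2 (push e) = map (@ssval _ L) (unzip2 e).
  by rewrite /unzip2 -!map_comp.
have [||||f fP] := @finite_separating U (fun e => E (push e)).
- move=> e /E_uniq.
  by rewrite /ends push1 push2 -map_cat => /map_uniq.
- by move=> e /E_neq0; rewrite size_map.
- by move=> e /E_flip; rewrite /push /flip -!map_comp.
- move=> v i; have [s s_size sP] := E_sparse ((@ssval _ L) v) i.
  exists [seq [seq (insubd v p.1, insubd v p.2) | p <- e] | e <- s].
    by rewrite size_map.
  move=> e Ee se ve; apply/mapP; exists (push e).
    by apply: sP; rewrite ?size_map // push1 map_f.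
  by rewrite -map_comp map_id_in // => -[a b] _ /=; rewrite !valKd.
exists (fun v => if insub v is Some u then f u else ord0) => e Ee eL.
have [e' ee'] : exists e', e = push e'.
  elim: e {Ee} eL => [|[a b] e IHe] eL; first by exists [::].
  have [x|e' ->] := IHe.
    rewrite mem_cat => xe; apply: eL; rewrite mem_cat !inE.
    by case/orP: xe => ->; rewrite !orbT.
  have aL : a \in L by apply: eL; rewrite mem_cat !inE eqxx.
  have bL : b \in L by apply: eL; rewrite mem_cat !inE eqxx !orbT.
  by exists ((SeqSub aL, SeqSub bL) :: e').
rewrite ee' in Ee *; have := fP _ Ee; rewrite /separates has_map.
by congr is_true; apply: eq_has => -[a b] /=; rewrite !valK.
Qed.

(** Each constraint is satisfied by all but finitely many of the colorings that
    are proper on longer and longer initial segments of V, so by every cluster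
    point of that sequence, which agrees with infinitely many of its terms on
    any finite set. *)
Lemma countable_separating (enum : nat -> V) :
  (forall v, exists i, enum i = v) ->
  exists f : V -> 'I_10, forall e, E e -> separates f e.
Proof.
move=> enumP.
have [fs fsP] := choice (fun n => separating_seq (mkseq enum n)).
pose F := (fs : nat -> {ptws V -> discrete_topology 'I_10}) @ \oo.
have [f [_ fF]] : [set f : {ptws V -> discrete_topology 'I_10} |
    forall v, [set: discrete_topology 'I_10] (f v)] `&` cluster F !=set0.
  apply: (@tychonoff V (fun=> discrete_topology 'I_10) (fun=> setT)).
    by move=> _; apply: finite_compact; apply: (@finite_finset 'I_10 setT).
  exact: filterS filterT.
exists f => e Ee.
have [N eN] : exists N, {subset ends e <= mkseq enum N}.
  elim: (ends e) => [|v s [N sN]]; first by exists 0.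
  have [i iv] := enumP v; exists (maxn i.+1 N) => w; rewrite in_cons.
  move=> /predU1P[->|/sN /mapP[j + ->]].
    by rewrite -iv; apply: map_f; rewrite mem_iota; lia.
  by rewrite mem_iota => jN; apply: map_f; rewrite mem_iota; lia.
have /fF/(_ (nbhs_agree f (ends e))) :
    F [set h : {ptws V -> discrete_topology 'I_10} | separates h e].
  exists N => // n /= Nn; apply: fsP => // v /eN /mapP[j + ->].
  by rewrite mem_iota => jN; apply: map_f; rewrite mem_iota; lia.
move=> [h [he hf]]; move: he; congr is_true; apply: eq_in_has => p pe.
by rewrite !hf // mem_cat map_f ?orbT.
Qed.
End Countable.

Local Open Scope group_scope.

(** * Groups and cosets *)

(** Words in the generators and their inverses form a countable type that maps
    onto the group. *)
Lemma finitely_generated_code (G : groupType) : finitely_generated G ->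
  exists (code : G -> nat) (decode : nat -> G), cancel code decode.
Proof.
move=> [S [/finite_seqP[s ->] genS]].
pose letter (p : nat * bool) := let g := nth 1 s p.1 in if p.2 then g^-1 else g.
pose ev w := foldr (fun p g => letter p * g) 1 w.
have ev_cat w1 w2 : ev (w1 ++ w2) = ev w1 * ev w2.
  by elim: w1 => [|p w1 IH] /=; rewrite ?mul1g // IH mulgA.
have ev_inv w : exists w', ev w' = (ev w)^-1.
  elim: w => [|[i b] w [w' IH]]; first by exists [::]; rewrite /= invg1.
  exists (w' ++ [:: (i, ~~ b)]); rewrite ev_cat IH /= invgM mulg1.
  by congr (_ * _); rewrite /letter; case: b => //=; rewrite invgK.
have ev_onto g : exists w, ev w = g.
  have : generated [set` s] g by rewrite genS.
  suff /smallest_sub sub : subgroup (range ev).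
    move=> /sub -[] => [h /= hs|w _ <-]; last by exists w.
    exists [:: (index h s, false)] => //=.
    by rewrite /letter /= nth_index ?mulg1.
  split; first by apply/mem_set; exists [::].
  move=> u v /set_mem[w1 _ <-] /set_mem[w2 _ <-]; apply/mem_set.
  by have [w' w'E] := ev_inv w2; exists (w1 ++ w'); rewrite // ev_cat w'E.
have [word wordK] := choice ev_onto.
exists (pickle \o word), (fun n => ev (odflt [::] (unpickle n))) => g.
by rewrite /comp pickleK /=.
Qed.

Lemma shiftM (G : groupType) (A : finType) (g h : G) (x : config G A) :
  shift g (shift h x) = shift (g * h) x.
Proof. by apply/funext => k; rewrite /shift invgM mulgA. Qed.

(** If x and its translate by g^-1 have the same stabiliser, conjugation by g
    preserves it. *)
Lemma stabs_singleton_normal (G : groupType) (A : finType) (H : set G)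
    (X : set (config G A)) :
  subshift X -> X !=set0 -> stabs X = [set H] ->
  forall g h, H h -> H (h ^ g).
Proof.
move=> [Xinv _] [x Xx] stX g h.
have stabE y : X y -> stab y = H.
  by move=> Xy; have : stabs X (stab y) by [exists y]; rewrite stX.
rewrite -{1}(stabE _ Xx) -(stabE _ (Xinv g^-1 _ Xx)) /= => hx.
by rewrite /stab /= shiftM /conjg -!mulgA mulgV mulg1 -shiftM hx.
Qed.

Section Cosets.
Variables (G : groupType) (H : set G).
Hypothesis sgH : subgroup H.

Lemma subgroup1 : H 1.
Proof. by have [/set_mem] := sgH. Qed.

Lemma subgroup_div g h : H g -> H h -> H (g / h).
Proof.
by have [_ Hdiv] := sgH; move=> /mem_set Hg /mem_set Hh; apply/set_mem/Hdiv.
Qed.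

Lemma subgroupV g : H g -> H g^-1.
Proof. by move=> /(subgroup_div subgroup1); rewrite /= mul1g. Qed.

Lemma subgroupM g h : H g -> H h -> H (g * h).
Proof. by move=> Hg /subgroupV /(subgroup_div Hg); rewrite /= invgK. Qed.

(** Two elements of one coset g H get the same representative, because the
    choice operator is applied to the same set. Representatives stand for the
    cosets, so that the vertices to be colored stay in G. *)
Definition coset_rep (g : G) : G := xget 1 [set h | H (g^-1 * h)].

Lemma coset_repP g : H (g^-1 * coset_rep g).
Proof.
rewrite /coset_rep; case: xgetP => [h _ //|/(_ g)].
by rewrite /= mulVg => /(_ subgroup1).
Qed.

Lemma eq_coset_rep g h : coset_rep g = coset_rep h <-> H (g^-1 * h).
Proof.
split=> [gh|Hgh].
  have := subgroup_div (coset_repP g) (coset_repP h).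
  by rewrite gh invgM invgK mulgA mulgK.
congr xget; apply/funext => k; apply/propext; split=> [Hk|Hk].
  have := subgroupM (subgroupV Hgh) Hk.
  by rewrite /= invgM invgK -mulgA mulVKg.
by have := subgroupM Hgh Hk; rewrite /= -mulgA mulVKg.
Qed.

Lemma eq_coset_rep_mull k g h :
  (coset_rep (k * g) == coset_rep (k * h)) = (coset_rep g == coset_rep h).
Proof.
by apply/eqP/eqP => /eq_coset_rep gh; apply/eq_coset_rep; move: gh;
  rewrite invgM -mulgA mulKg.
Qed.

Lemma uniq_coset_rep_mull k (s : seq G) :
  uniq [seq coset_rep (k * g) | g <- s] = uniq (map coset_rep s).
Proof.
elim: s => //= g s ->; congr (~~ _ && _).
by apply/mapP/mapP => -[h hs /eqP gh]; exists h => //; apply/eqP;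
  rewrite eq_coset_rep_mull in gh *.
Qed.

(** * Windows and the subshift *)

(** A period g outside H of x would contradict the window condition at
    the position h = 1, which compares x t with x (g t). *)
Lemma subshift_of_coloring (A : finType) (x0 : G -> A) (T : G -> seq G) :
  (forall g h, H h -> H (h ^ g)) ->
  (forall g k, H k -> x0 (g * k) = x0 g) ->
  (forall g h, ~ H g -> has (fun t => x0 (h * t) != x0 (h * g * t)) (T g)) ->
  exists X : set (config G A), [/\ X !=set0, subshift X & stabs X = [set H]].
Proof.
move=> HJ x0H x0T.
pose X := [set x : config G A | (forall g k, H k -> x (g * k) = x g) /\
  (forall g h, ~ H g -> has (fun t => x (h * t) != x (h * g * t)) (T g))].
have stabX x : X x -> stab x = H.
  move=> [xH xT]; apply/seteqP; split=> g.
    rewrite /stab /= => gx; apply: contrapT => /(xT _ 1)/hasP[t _].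
    by rewrite !mul1g -{2}gx /shift mulKg eqxx.
  move=> Hg; apply/funext => h; rewrite /shift.
  by rewrite -(xH h (g^-1 ^ h)) ?mulVKg //; apply/HJ/subgroupV.
have Xx0 : X x0 by [].
exists X; split; first by exists x0.
  split=> [g x [xH xT]|].
    split=> [h k Hk|h k Hh]; first by rewrite /shift mulgA xH.
    have := xT h (g^-1 * k) Hh; congr is_true.
    by apply: eq_has => t; rewrite /shift !mulgA.
  apply: closed_agree => x nXx; apply: contrapT => nfin; apply: nXx.
  split=> [g k Hk|g h Hg]; apply: contrapT => bad; apply: nfin.
    exists [:: g * k; g] => y [yH _] yx; apply: bad.
    by rewrite -!yx ?inE ?eqxx ?orbT // yH.
  exists ([seq h * t | t <- T g] ++ [seq h * g * t | t <- T g]).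
  move=> y [_ yT] yx; apply: bad; have := yT g h Hg; congr is_true.
  by apply: eq_in_has => t tT; rewrite !yx // mem_cat map_f ?orbT.
apply/seteqP; split=> [_ [x Xx <-]|_ ->]; first exact: stabX.
by exists x0 => //; apply: stabX.
Qed.

Hypothesis HJ : forall g h, H h -> H (h ^ g).

(** Windows grow greedily: the coset of a new point t must differ from that of
    u, g u and g^-1 u for each u already chosen. The cosets of t and g t are
    then distinct because g is not in the normal subgroup H. *)
Lemma disjoint_window (g : G) n :
  (forall L : seq G, exists t, coset_rep t \notin L) -> ~ H g ->
  exists2 T : seq G, size T = n &
    uniq (map coset_rep T ++ map (fun t => coset_rep (g * t)) T).
Proof.
move=> inf Hg; elim: n => [|n [T sT uT]]; first by exists [::].
have [t] := inf (map coset_rep T ++ map (fun t => coset_rep (g * t)) T ++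
  map (fun t => coset_rep (g^-1 * t)) T).
rewrite !mem_cat !negb_or => /and3P[t1 t2 t3].
exists (t :: T); first by rewrite /= sT.
rewrite /= mem_cat inE !negb_or t1 t2 /= andbT; apply/andP; split.
  apply/eqP => /eq_coset_rep Ht; apply: Hg.
  have := HJ t^-1 Ht.
  by rewrite /conjg invgK -!mulgA mulVKg mulgV mulg1.
rewrite -cat1s uniq_catCA cat1s /= uT andbT mem_cat negb_or; apply/andP; split.
  apply/mapP => -[u uT' /eqP]; rewrite -(mulVKg g u).
  rewrite eq_coset_rep_mull => /eqP ut.
  by case/mapP: t3; exists u.
by apply/mapP => -[u uT' /eqP]; rewrite eq_coset_rep_mull => /eqP ut;
  case/mapP: t1; exists u.
Qed.

(** With each coset colored by itself, the colors at h and h g differ as soon as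
    g is outside H. *)
Lemma finite_index_subshift (L : seq G) :
  (forall t, coset_rep t \in L) ->
  exists (A : finType) (X : set (config G A)),
    [/\ (0 < #|A|)%N, X !=set0, subshift X & stabs X = [set H]].
Proof.
move=> Lall.
pose x0 g : seq_sub L := SeqSub (Lall g).
exists (seq_sub L).
have [] := @subshift_of_coloring (seq_sub L : finType) x0 (fun=> [:: 1]) HJ.
- move=> g k Hk; apply/val_inj/eq_coset_rep.
  by rewrite invgM mulgVK; apply: subgroupV.
- move=> g h Hg; rewrite /= orbF !mulg1; apply/eqP => /(congr1 val) /=.
  by move/eq_coset_rep; rewrite mulKg.
by move=> X [X0 sX stX]; exists X; split=> //; apply/card_gt0P; exists (x0 1).
Qed.

(** The constraints are the pairs of words read along h T_g and h g T_g. Windows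
    of distinct elements have distinct sizes, so a constraint of size i.+1
    comes from the one g of code i. If its first word passes through the vertex
    v at the position t, then h is v / t up to an element of H, which
    does not change the constraint; t ranges over i.+1 values. The second word
    is handled in the same way. *)
Lemma infinite_index_subshift (code : G -> nat) (decode : nat -> G) :
  cancel code decode ->
  (forall L : seq G, exists t, coset_rep t \notin L) ->
  exists (A : finType) (X : set (config G A)),
    [/\ (0 < #|A|)%N, X !=set0, subshift X & stabs X = [set H]].
Proof.
move=> codeK inf.
have /choice[T TP] : forall g, exists T, ~ H g -> size T = (code g).+1 /\
    uniq (map coset_rep T ++ map (fun t => coset_rep (g * t)) T).
  move=> g; have [Hg|Hg] := pselect (H g); first by exists [::].
  by have [T ? ?] := disjoint_window (code g).+1 inf Hg; exists T.
pose pairs g h := [seq (coset_rep (h * t), coset_rep (h * g * t)) | t <- T g].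
pose E e := exists g h, ~ H g /\ (e = pairs g h \/ e = flip (pairs g h)).
have size_pairs g h : ~ H g -> size (pairs g h) = (code g).+1.
  by move=> /TP[sT _]; rewrite size_map.
have size_flip (e : seq (G * G)) : size (flip e) = size e by rewrite size_map.
have uniq_ends e : uniq (ends (flip e)) = uniq (ends e) :> bool.
  by rewrite /ends unzip1_flip unzip2_flip uniq_catC.
have uniq_pairs g h : ~ H g -> uniq (ends (pairs g h)).
  move=> /TP[_].
  have -> : ends (pairs g h) = map (fun t => coset_rep (h * t))
      (T g ++ map (fun t => g * t) (T g)).
    rewrite map_cat -map_comp /ends /unzip1 /unzip2 -!map_comp.
    by congr (_ ++ _); apply: eq_map => t /=; rewrite mulgA.
  by rewrite uniq_coset_rep_mull map_cat -map_comp.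
have pairs_coset g h k : H (h^-1 * k) -> pairs g h = pairs g k.
  move=> Hhk; apply: eq_map => t.
  have shift_rep u : coset_rep (h * u) = coset_rep (k * u).
    by apply/eq_coset_rep; have := HJ u Hhk; rewrite /conjg invgM !mulgA.
  by rewrite -!mulgA !shift_rep.
have [|||||f fE] := @countable_separating G E _ _ _ _ decode.
- move=> e [g [h [Hg [->|->]]]]; rewrite ?uniq_ends; exact: uniq_pairs.
- by move=> e [g [h [Hg [->|->]]]]; rewrite ?size_flip size_pairs.
- by move=> e [g [h [Hg [->|->]]]]; exists g, h; split=> //;
    rewrite ?flipK; [right|left].
- move=> v i; pose g := decode i.
  have only_g e : E e -> size e = i.+1 -> ~ H g /\ code g = i /\
      exists h, e = pairs g h \/ e = flip (pairs g h).
    move=> [g' [h [Hg' e_def]]] se.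
    have ci : code g' = i.
      by apply: succn_inj; rewrite -se -(size_pairs g' h Hg');
        case: e_def => ->; rewrite ?size_flip.
    have -> : g = g' by rewrite /g -ci codeK.
    by split=> //; split=> //; exists h.
  have [[Hg ci]|no_g] := pselect (~ H g /\ code g = i); last first.
    by exists [::] => // e Ee se _; case: no_g; have [? []] := only_g e Ee se.
  have [sT _] := TP g Hg.
  exists ([seq pairs g (v / t) | t <- T g] ++
          [seq flip (pairs g (v / (g * t))) | t <- T g]).
    by rewrite size_cat !size_map sT ci addnn.
  (* The position h is recovered, up to H, from a vertex of its word. *)
  have back h u : v = coset_rep (h * u) -> H (h^-1 * (v / u)).
    move=> ->; have := HJ u^-1 (coset_repP (h * u)).
    by rewrite /conjg invgK invgM -!mulgA mulVKg.
  move=> e Ee se; have [_ [_ [h [->|->]]]] := only_g e Ee se.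
    move=> /mapP[_ /mapP[t tT ->] /= vt]; rewrite mem_cat; apply/orP; left.
    by apply/mapP; exists t => //; apply/pairs_coset/back.
  rewrite unzip1_flip => /mapP[_ /mapP[t tT ->] /= vt].
  rewrite mem_cat; apply/orP; right.
  apply/mapP; exists t => //; congr flip; apply/pairs_coset/back.
  by rewrite mulgA.
- by move=> g; exists (code g).
exists 'I_10.
have [] := @subshift_of_coloring 'I_10 (f \o coset_rep) T HJ.
- move=> g k Hk; congr f; apply/eq_coset_rep.
  by rewrite invgM mulgVK; apply: subgroupV.
- move=> g h Hg; have : separates f (pairs g h) by apply: fE; exists g, h; auto.
  by rewrite /separates has_map.
by move=> X [X0 sX stX]; exists X; rewrite card_ord.
Qed.

End Cosets.

(** * The characterisation of normal subgroups *)

Theorem proposition4p13 (G : groupType) (fgG : finitely_generated G)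
    (H : set G) (sgH : subgroup H) :
  (exists (A : finType) (X : set (config G A)),
     [/\ (0 < #|A|)%N, X !=set0, subshift X & stabs X = [set H]])
  <-> normal_subgroup H.
Proof.
split=> [[A [X [_ X0 sX stX]]]|[_ HJ]].
  by split=> //; apply: stabs_singleton_normal sX X0 stX.
have [[L Lall]|inf] :=
  pselect (exists L : seq G, forall t, coset_rep H t \in L).
  exact: finite_index_subshift Lall.
have [code [decode codeK]] := finitely_generated_code fgG.
apply: (infinite_index_subshift sgH HJ codeK) => L.
apply: contrapT => nt; apply: inf; exists L => t.
by apply: contrapT => tL; apply: nt; exists t; apply/negP.
Qed.
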